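(* Consider problem (EP) with $A$ and $D$ in canonical form. If the optimal value of (EP) is bounded from below, then: 1. $\dim E_i\le2$ for $i=1,\ldots,p$, $\dim E_i=1$ for $i=p+1,\ldots,m$, and no Jordan block $J(\kappa_i,n_i)$ has a complex (non-real) pair of eigenvalues. 2. If $\dim E_i=2$ for some index $i$, let $r,r+1$ be the coordinates of the $i$th block and $\pi=\tau_i\bar x_r\bar x_{r+1}$ for a feasible point $\bar x$ of (EP). Then $\tau_i=1$ and one of the following holds: ($e_r=0$, $e_{r+1}\ne0$); ($e_r=0$, $e_{r+1}=0$, $\pi=0$); ($e_r=0$, $e_{r+1}=0$, $\pi\ne0$).
   Context: Problem (EP) is $\min\{f(x)=\tfrac12x^TDx+e^Tx \;:\; h(x)=\tfrac12x^TAx+b^Tx+c= 0,\ x\in\mathbb R^n\}$, with $A,D$ real symmetric $n\times n$, $b,e\in\mathbb R^n$, $c\in\mathbb R$. Standing assumption: (EP) is feasible; the three conditions $A\succeq0$, $b\in\mathrm{Range}(A)$, $c=\frac12b^TA^+b$ do not all hold simultaneously; $A\ne0$; and the two-sided Slater condition holds: there exist $x',x''$ with $h(x')<0<h(x'')$. Canonical form: $$A=\mathrm{diag}(\tau_1E_1,\ldots,\tau_kE_k,\tau_{k+1}E_{k+1},\ldots,\tau_pE_p,\tau_{p+1}F_{p+1},\ldots,\tau_mF_m,0,\ldots,0),$$ $$D=\mathrm{diag}(\tau_1E_1J(\kappa_1,n_1),\ldots,\tau_kE_kJ(\kappa_k,n_k),\tau_{k+1}F_{k+1},\ldots,\tau_pF_p,\tau_{p+1}E_{p+1},\ldots,\tau_mE_m,0,\ldots,0),$$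 with $\tau_i=\pm1$ and corresponding blocks of equal size $n_i$. Here $E$ of size $q$ has entries $1$ where $r+s=q+1$ and $0$ elsewhere; $F$ of size $q$ has entries $1$ where $r+s=q+2$ and $0$ elsewhere; $J(\kappa,q)$ is a $q\times q$ real Jordan block: for real $\kappa$, $\kappa$ on the diagonal and $1$ on the superdiagonal; for a complex pair $a\pm b\mathrm i$, $b\ne0$, block bidiagonal with diagonal blocks $\begin{pmatrix} a & -b \\ b & a \end{pmatrix}$ and identity $2\times2$ blocks on the block superdiagonal. Normalization: the entries of $b$ corresponding to any $2\times2$ block pair of the form $(\tau_iE_i,\tau_iE_iJ(\kappa_i,2))$ with real $\kappa_i$ (including $(\tau_iE_i,\tau_iF_i)$ of size 2) are $0$. *)

(* Defs.v *)
From HB Require Import structures.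
From mathcomp Require Import all_boot all_order all_algebra.
From mathcomp Require Import complex.
From mathcomp Require Import boolp classical_sets reals ereal.

Set Implicit Arguments.
Unset Strict Implicit.
Unset Printing Implicit Defensive.

Import Order.TTheory GRing.Theory Num.Theory.
Local Open Scope ring_scope.
Local Open Scope classical_set_scope.

Definition quad (R : realType) (n : nat) (M : 'M[R]_n) (v : 'cV[R]_n) (a : R)
    (x : 'cV[R]_n) : R :=
  2^-1 * (x^T *m M *m x) 0 0 + (v^T *m x) 0 0 + a.

Definition ep_obj (R : realType) (n : nat) (D : 'M[R]_n) (e x : 'cV[R]_n) : R :=
  quad D e 0 x.

Definition ep_cstr (R : realType) (n : nat) (A : 'M[R]_n) (b : 'cV[R]_n) (c : R)
    (x : 'cV[R]_n) : R :=
  quad A b c x.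

Definition ep_feasible (R : realType) (n : nat) (A : 'M[R]_n) (b : 'cV[R]_n)
    (c : R) : set 'cV[R]_n :=
  [set x | ep_cstr A b c x = 0].

Definition ep_value (R : realType) (n : nat) (D A : 'M[R]_n) (e b : 'cV[R]_n)
    (c : R) : \bar R :=
  ereal_inf [set (ep_obj D e x)%:E | x in ep_feasible A b c].

Definition psdmx (R : realType) (n : nat) (A : 'M[R]_n) : Prop :=
  forall x : 'cV[R]_n, 0 <= (x^T *m A *m x) 0 0.

(* A^+ from the full-rank factorization A = B C, namely
   A^+ = C^T (C C^T)^-1 (B^T B)^-1 B^T.  MathComp's pinvmx is only a generalized
   inverse; mpinvP and mpinv_unique characterize this one by the four Penrose
   equations. *)
Definition mpinv (R : realType) (m n : nat) (A : 'M[R]_(m, n)) : 'M[R]_(n, m) :=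
  let B := col_base A in
  let C := row_base A in
  C^T *m invmx (C *m C^T) *m invmx (B^T *m B) *m B^T.

Definition penrose (R : realType) (m n : nat) (A : 'M[R]_(m, n))
    (X : 'M[R]_(n, m)) : Prop :=
  [/\ A *m X *m A = A, X *m A *m X = X,
      (A *m X)^T = A *m X & (X *m A)^T = X *m A].

Lemma gram_unit (R : realType) (r n : nat) (C : 'M[R]_(r, n)) :
  row_free C -> C *m C^T \in unitmx.
Proof.
move=> fC; rewrite -row_free_unit -kermx_eq0.
apply/eqP/row_matrixP => i; rewrite row0.
set u := row i _.
have /sub_kermxP uG : (u <= kermx (C *m C^T))%MS by apply: row_sub.
have w0 : u *m C = 0.
  have : (u *m C) *m (u *m C)^T = 0.
    by rewrite trmx_mul mulmxA -(mulmxA u) uG mul0mx.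
  move=> /matrixP /(_ 0 0); rewrite !mxE => /eqP.
  rewrite psumr_eq0 => [/allP w0|j _]; last by rewrite !mxE -expr2 sqr_ge0.
  apply/rowP => j; move: (w0 j (mem_index_enum j)).
  by rewrite implyTb [_^T _ _]mxE mulf_eq0 orbb => /eqP ->; rewrite mxE.
by apply: (row_free_inj fC); rewrite w0 mul0mx.
Qed.

Lemma full_rank_penrose (R : realType) (m r n : nat) (B : 'M[R]_(m, r))
    (C : 'M[R]_(r, n)) :
  row_full B -> row_free C ->
  penrose (B *m C) (C^T *m invmx (C *m C^T) *m invmx (B^T *m B) *m B^T).
Proof.
move=> fB fC; have uC := gram_unit fC.
have uB : B^T *m B \in unitmx.
  by rewrite -{2}(trmxK B); apply: gram_unit; rewrite /row_free mxrank_tr.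
have GT : (invmx (C *m C^T))^T = invmx (C *m C^T).
  by rewrite trmx_inv trmx_mul trmxK.
have HT : (invmx (B^T *m B))^T = invmx (B^T *m B).
  by rewrite trmx_inv trmx_mul trmxK.
have AX : (B *m C) *m (C^T *m invmx (C *m C^T) *m invmx (B^T *m B) *m B^T)
    = B *m invmx (B^T *m B) *m B^T.
  by rewrite !mulmxA -(mulmxA B C) -(mulmxA B (C *m C^T)) mulmxV // mulmx1.
have XA : (C^T *m invmx (C *m C^T) *m invmx (B^T *m B) *m B^T) *m (B *m C)
    = C^T *m invmx (C *m C^T) *m C.
  rewrite !mulmxA -(mulmxA _ B^T B) -(mulmxA _ (invmx (B^T *m B))).
  by rewrite mulVmx // mulmx1.
split.
- rewrite AX mulmxA -(mulmxA _ B^T B) -(mulmxA _ (invmx (B^T *m B))).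
  by rewrite mulVmx // mulmx1.
- rewrite XA !mulmxA -(mulmxA _ C C^T) -(mulmxA _ (C *m C^T)).
  by rewrite mulmxV // mulmx1.
- by rewrite AX !trmx_mul trmxK HT mulmxA.
- by rewrite XA !trmx_mul trmxK GT mulmxA.
Qed.

Lemma mpinvP (R : realType) (m n : nat) (A : 'M[R]_(m, n)) : penrose A (mpinv A).
Proof.
have := full_rank_penrose (col_base_full A) (row_base_free A).
by rewrite mulmx_base.
Qed.

Lemma mpinv_unique (R : realType) (m n : nat) (A : 'M[R]_(m, n))
    (X : 'M[R]_(n, m)) :
  penrose A X -> X = mpinv A.
Proof.
move: (mpinvP A); move: (mpinv A) => Y [Y1 Y2 Y3 Y4] [X1 X2 X3 X4].
have AXY : A *m X = A *m Y.
  rewrite -X3 -{1}Y1 -[(A *m Y *m A) *m X]mulmxA trmx_mul X3 Y3.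
  by rewrite mulmxA X1.
have XAY : X *m A = Y *m A.
  rewrite -X4 -{1}Y1 -(mulmxA A) mulmxA trmx_mul X4 Y4.
  by rewrite -mulmxA (mulmxA A) X1.
by rewrite -X2 XAY -mulmxA AXY mulmxA Y2.
Qed.

Definition ep_assumption (R : realType) (n : nat) (A : 'M[R]_n) (b : 'cV[R]_n)
    (c : R) : Prop :=
  [/\ exists x, ep_feasible A b c x,
      ~ [/\ psdmx A, (exists y : 'cV[R]_n, b = A *m y)
          & c = 2^-1 * (b^T *m mpinv A *m b) 0 0],
      A <> 0
    & exists x' x'' : 'cV[R]_n, ep_cstr A b c x' < 0 < ep_cstr A b c x''].

(* In entry formulas, 1-based indices are r.+1 and s.+1. *)
Definition Emx (R : realType) (q : nat) : 'M[R]_q :=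
  \matrix_(r, s) (r.+1 + s.+1 == q.+1)%N%:R.

Definition Fmx (R : realType) (q : nat) : 'M[R]_q :=
  \matrix_(r, s) (r.+1 + s.+1 == q.+2)%N%:R.

Definition Jreal (R : realType) (kappa : R) (q : nat) : 'M[R]_q :=
  \matrix_(r, s) if s == r then kappa
                 else if (s == r.+1 :> nat) then 1 else 0.

(* Meant for even q: entry (r, s) lies in the 2x2 block (r./2, s./2), at
   position (odd r, odd s) inside it. *)
Definition Jpair (R : realType) (a b : R) (q : nat) : 'M[R]_q :=
  \matrix_(r, s)
    if s./2 == r./2 then
      if odd r == odd s then a else if odd r then b else - b
    else if s./2 == (r./2).+1 then (odd r == odd s)%:R
    else 0.

(* A non-real kappa = a + ib stands for the pair a +- ib. *)
Definition Jmx (R : realType) (kappa : complex R) (q : nat) : 'M[R]_q :=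
  if complex.Im kappa == 0 then Jreal (complex.Re kappa) q
  else Jpair (complex.Re kappa) (complex.Im kappa) q.

(* Block indices are 0-based: i < k, k <= i < p and p <= i < m are the three
   families of blocks, in this order; cf_zeros is the size of the trailing zero
   block, and cf_kappa i is irrelevant when k <= i. *)
Record block_form (R : realType) := BlockForm {
  cf_k : nat;
  cf_p : nat;
  cf_m : nat;
  cf_zeros : nat;
  cf_size : 'I_cf_m -> nat;
  cf_tau : 'I_cf_m -> R;
  cf_kappa : 'I_cf_m -> complex R;
  cf_k_le_p : (cf_k <= cf_p)%N;
  cf_p_le_m : (cf_p <= cf_m)%N;
  cf_size_gt0 : forall i, (0 < cf_size i)%N;
  cf_tauP : forall i, cf_tau i = 1 \/ cf_tau i = -1;
  cf_pair_even : forall i : 'I_cf_m, (i < cf_k)%N ->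
    complex.Im (cf_kappa i) <> 0 -> ~~ odd (cf_size i)
}.

Definition cf_dim (R : realType) (K : block_form R) : nat :=
  (\sum_(i < cf_m K) cf_size i + cf_zeros K)%N.

Definition cf_Ablock (R : realType) (K : block_form R) (i : 'I_(cf_m K)) :
    'M[R]_(cf_size i) :=
  cf_tau i *: (if (i < cf_p K)%N then Emx R (cf_size i) else Fmx R (cf_size i)).

Definition cf_Dblock (R : realType) (K : block_form R) (i : 'I_(cf_m K)) :
    'M[R]_(cf_size i) :=
  cf_tau i *: (if (i < cf_k K)%N
                 then Emx R (cf_size i) *m Jmx (cf_kappa i) (cf_size i)
               else if (i < cf_p K)%N then Fmx R (cf_size i)
               else Emx R (cf_size i)).

Definition cf_A (R : realType) (K : block_form R) : 'M[R]_(cf_dim K) :=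
  block_mx (\mxdiag_(i < cf_m K) cf_Ablock i) 0 0 0.

Definition cf_D (R : realType) (K : block_form R) : 'M[R]_(cf_dim K) :=
  block_mx (\mxdiag_(i < cf_m K) cf_Dblock i) 0 0 0.

(* Global coordinate of the j-th coordinate of block i; see cf_coordE. *)
Definition cf_coord (R : realType) (K : block_form R) (i : 'I_(cf_m K))
    (j : 'I_(cf_size i)) : 'I_(cf_dim K) :=
  lshift (cf_zeros K) (tagnat.Rank i j).

Lemma cf_coordE (R : realType) (K : block_form R) (i : 'I_(cf_m K))
    (j : 'I_(cf_size i)) :
  cf_coord j = (\sum_(l < cf_m K | (l < i)%N) cf_size l + j)%N :> nat.
Proof. exact: tagnat.RankEsum. Qed.

Definition cf_normalized (R : realType) (K : block_form R)
    (b : 'cV[R]_(cf_dim K)) : Prop :=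
  forall i : 'I_(cf_m K), (i < cf_p K)%N -> cf_size i = 2%N ->
    ((i < cf_k K)%N -> complex.Im (cf_kappa i) = 0) ->
    forall j : 'I_(cf_size i), b (cf_coord j) 0 = 0.

(* Main.v *)
(** A bounded optimal value yields, by the S-lemma with equality, a multiplier
    [mu] with [f + mu h] bounded below on the whole space. The S-lemma is proved
    by homogenizing: [F] and [H] are the forms of [f - v] and [h] in one more
    variable [t]; [F >= 0] on the cone [H = 0] off [t = 0] by hypothesis, hence
    on the whole cone by density because [A <> 0], and Finsler's theorem applies
    because [H] is indefinite. Then [F + mu H] is positive semidefinite, so a
    zero on its diagonal forces a zero row. In a block pair of size at least 3,
    or at least 2 in the third family, the anti-triangular shape of [E], [F] and
    [E J] puts a zero on the diagonal in a row that is not zero; in a block of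
    size 2 that row is zero in the [A], [D] part, and its entry in the extra
    column is [e_r + mu b_r = e_r]. *)

Require Import Defs.
From HB Require Import structures.
From mathcomp Require Import all_boot all_order all_algebra.
From mathcomp Require Import complex.
From mathcomp Require Import boolp classical_sets reals ereal.
From mathcomp Require Import polyrcf.
From mathcomp Require Import ring lra zify.

Set Implicit Arguments.
Unset Strict Implicit.
Unset Printing Implicit Defensive.

Import Order.TTheory GRing.Theory Num.Theory.
Local Open Scope ring_scope.
Local Open Scope classical_set_scope.

(** Continuity at 0. It carries out the passage to the limit in the density argument for the
    isotropic cone. *)
Lemma horner0_ge0 (R : rcfType) (p : {poly R}) :
  (forall x, 0 < x -> 0 <= p.[x]) -> 0 <= p.[0].
Proof.
move=> p_ge0; rewrite leNgt; apply/negP => p0_lt0.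
have [|d d_gt0 pd] := @poly_cont R 0 p (- p.[0]); first by rewrite oppr_gt0.
have := pd (d / 2); rewrite subr0 gtr0_norm ?divr_gt0// ltr_pdivrMr//.
rewrite ltr_pMr// ltr1n => /(_ isT).
have := p_ge0 (d / 2); rewrite divr_gt0// => /(_ isT) pd2.
by move=> /(le_lt_trans (ler_norm _)); rewrite ltrBlDr addNr ltNge pd2.
Qed.

(** * Symmetric bilinear forms and their isotropic cones *)

Section SymmetricForms.
Variables (R : rcfType) (V : lmodType R).
Implicit Types (B F H : V -> V -> R) (x y z u v w : V).

Definition symmetric_form B :=
  (forall x y, B x y = B y x) /\ (forall y, scalar (B^~ y)).

Lemma form_linr B : symmetric_form B -> forall a b x y z,
  B z (a *: x + b *: y) = a * B z x + b * B z y.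
Proof.
move=> [BC Bl] a b x y z; rewrite BC Bl -[b *: y]addr0 Bl.
have B0 : B 0 z = 0 by have := Bl z 1 0 0; rewrite scale1r addr0; lra.
by rewrite B0 addr0 !(BC z).
Qed.

Lemma form_comb B : symmetric_form B -> forall a b x y,
  let z := a *: x + b *: y in
  B z z = a ^+ 2 * B x x + 2 * a * b * B x y + b ^+ 2 * B y y.
Proof.
move=> symB a b x y z; rewrite {2}/z (form_linr symB).
by rewrite !(symB.1 z) /z !(form_linr symB) (symB.1 y x); ring.
Qed.

Lemma form_add B (k : R) F : symmetric_form F -> symmetric_form B ->
  symmetric_form (fun x y => F x y + k * B x y).
Proof.
move=> [FC Fl] [BC Bl]; split=> [x y|z a x y /=]; first by rewrite FC BC.
by rewrite Fl Bl; ring.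
Qed.

Lemma psd_form_isotropic B u : symmetric_form B -> (forall x, 0 <= B x x) ->
  B u u = 0 -> forall v, B u v = 0.
Proof.
(* With [B u u = 0] the coefficients are chosen so that the value at this vector is
   [- (B u v) ^+ 2 * (B v v + 2)]. *)
move=> symB B_ge0 Bu v; have := B_ge0 (- (B v v + 1) *: u + B u v *: v).
rewrite (form_comb symB) Bu mulr0 add0r => Bw.
have {}Bw : (B u v) ^+ 2 * (B v v + 2) <= 0.
  move: Bw; set s := B u v; set t := B v v.
  by rewrite -oppr_ge0; congr (0 <= _); ring.
have : (B u v) ^+ 2 <= 0.
  by rewrite pmulr_lle0 in Bw => //; have := B_ge0 v; lra.
by move=> ?; apply/eqP; rewrite -sqrf_eq0 eq_le sqr_ge0 andbT.
Qed.

(* The line through [u] and [w] meets the cone [H = 0] at [u + t1 w] and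
   [u + t2 w] with [t1 t2 = H u u / H w w < 0]; the convex combination of the
   two values of [F] without cross term is the claim. *)
Lemma isotropic_nonneg_cross F H : symmetric_form F -> symmetric_form H ->
  (forall v, H v v = 0 -> 0 <= F v v) ->
  forall u w, H u u < 0 -> 0 < H w w -> H u u * F w w <= F u u * H w w.
Proof.
move=> symF symH FH u w Hu Hw.
set a := H w w in Hw *; set h := H u w; set c := H u u in Hu *.
set d := Num.sqrt (h ^+ 2 - a * c).
have ac : a * c < 0 by rewrite pmulr_rlt0.
have d2 : d ^+ 2 = h ^+ 2 - a * c by rewrite sqr_sqrtr //; have := sqr_ge0 h; lra.
have d_ge0 : 0 <= d := sqrtr_ge0 _.
have dh : `|h| < d.
  by rewrite -(@ltr_pXn2r _ 2)// ?nnegrE// ?real_normK ?num_real// d2; lra.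
have [hd1 hd2] : - d < h /\ h < d by move: dh; rewrite ltr_norml => /andP[].
have F1 : 0 <= F (a *: u + (d - h) *: w) (a *: u + (d - h) *: w).
  apply: FH; rewrite (form_comb symH) -/h -/a -/c.
  transitivity (a * (d ^+ 2 - (h ^+ 2 - a * c))); first by ring.
  by rewrite d2; ring.
have F2 : 0 <= F (a *: u + (- d - h) *: w) (a *: u + (- d - h) *: w).
  apply: FH; rewrite (form_comb symH) -/h -/a -/c.
  transitivity (a * (d ^+ 2 - (h ^+ 2 - a * c))); first by ring.
  by rewrite d2; ring.
rewrite !(form_comb symF) in F1 F2.
(* The weights [d + h] and [d - h] cancel the terms in [F u w], and [d ^+ 2 - h ^+ 2 = - a * c]
   gives the rest. *)
have : 0 <= 2 * d * a * (a * F u u - c * F w w).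
  have {}F1 := mulr_ge0 (_ : 0 <= d + h) F1.
  have {}F2 := mulr_ge0 (_ : 0 <= d - h) F2.
  have := addr_ge0 (F1 ltac:(lra)) (F2 ltac:(lra)).
  move/le_trans; apply; rewrite le_eqVlt; apply/orP; left; apply/eqP.
  set f := F u u; set g := F u w; set k := F w w.
  transitivity (2 * d * a ^+ 2 * f + 2 * d * (d ^+ 2 - h ^+ 2) * k); first by ring.
  by rewrite d2; ring.
have d_gt0 : 0 < d by apply: le_lt_trans dh; exact: normr_ge0.
by rewrite pmulr_rge0 ?mulr_gt0// subr_ge0 (mulrC a).
Qed.

(* The points [(H w w) v - 2 (H v w) w] are isotropic whenever [v] is; those off
   the hyperplane [t = 0] accumulate at a multiple of [v], taking [w] close to
   the orthogonal of [v]. *)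
Lemma isotropic_nonneg_extend F H (t : V -> R) :
  symmetric_form F -> symmetric_form H -> scalar t ->
  (forall v, t v != 0 -> H v v = 0 -> 0 <= F v v) ->
  (exists2 w, t w != 0 & H w w = 0) ->
  (exists2 z, t z = 0 & H z z != 0) ->
  forall v, H v v = 0 -> 0 <= F v v.
Proof.
move=> symF symH tl FH [w0 tw0 Hw0] [z tz Hz] v Hv.
have [tv|tv] := eqVneq (t v) 0; last exact: FH.
have t2 a b x y : t (a *: x + b *: y) = a * t x + b * t y.
  rewrite tl -[b *: y]addr0 tl.
  have -> : t 0 = 0 by have := tl 1 0 0; rewrite scale1r addr0; lra.
  by rewrite addr0.
(* Here [v + x w] is isotropic and off the hyperplane for every [x > 0], and it tends to [v]. *)
have case1 w : H v w = 0 -> H w w = 0 -> t w != 0 -> 0 <= F v v.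
  move=> Hvw Hw tw.
  pose p := (F v v)%:P + (2 * F v w)%:P * 'X + (F w w)%:P * 'X^2.
  have -> : F v v = p.[0] by rewrite /p !hornerE /=; ring.
  apply: horner0_ge0 => x x_gt0.
  have -> : p.[x] = F (1 *: v + x *: w) (1 *: v + x *: w).
    by rewrite (form_comb symF) /p !hornerE /=; ring.
  apply: FH; first by rewrite t2 tv mulr0 add0r mulf_neq0// gt_eqF.
  by rewrite (form_comb symH) Hv Hvw Hw; ring.
have [Hvw0|Hvw0] := eqVneq (H v w0) 0; first exact: (case1 w0).
(* The sign condition keeps [t (w + x w0)] nonzero for all [x > 0]. The polynomials [h] and [l] in
   [x] are [H wx wx] and [H v wx], so [p] is [F q q]. *)
have case2 w : H v w = 0 -> H w w != 0 -> 0 <= t w * t w0 -> 0 <= F v v.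
  move=> Hvw Hw tww0.
  pose h : {poly R} := (H w w)%:P + (2 * H w w0)%:P * 'X.
  pose l : {poly R} := (H v w0)%:P * 'X.
  pose p := h ^+ 2 * (F v v)%:P
    - 4%:P * h * l * ((F v w)%:P + (F v w0)%:P * 'X)
    + 4%:P * l ^+ 2 * ((F w w)%:P + (2 * F w w0)%:P * 'X + (F w0 w0)%:P * 'X^2).
  have -> : F v v = p.[0] / (H w w) ^+ 2.
    by rewrite /p /h /l !hornerE /=; field.
  rewrite divr_ge0 ?sqr_ge0//; apply: horner0_ge0 => x x_gt0.
  set wx := 1 *: w + x *: w0.
  have Hvwx : H v wx = x * H v w0 by rewrite (form_linr symH) Hvw; ring.
  have Hwx : H wx wx = H w w + 2 * H w w0 * x.
    by rewrite (form_comb symH) Hw0; ring.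
  have Fwx : F wx wx = F w w + 2 * F w w0 * x + F w0 w0 * x ^+ 2.
    by rewrite (form_comb symF); ring.
  have Fvwx : F v wx = F v w + x * F v w0 by rewrite (form_linr symF); ring.
  pose q := H wx wx *: v + (- 2 * H v wx) *: wx.
  have -> : p.[x] = F q q.
    by rewrite (form_comb symF) Hvwx Hwx Fwx Fvwx /p /h /l !hornerE /=; ring.
  apply: FH; last by rewrite (form_comb symH) Hv; ring.
  have twx : t wx != 0.
    rewrite t2 mul1r; apply: contraTneq tww0 => e; rewrite -ltNge.
    have -> : t w = - (x * t w0) by lra.
    by rewrite mulNr oppr_lt0 -mulrA -expr2 mulr_gt0// exprn_even_gt0.
  rewrite t2 tv mulr0 add0r !mulf_neq0// ?oppr_eq0 ?pnatr_eq0// Hvwx.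
  by rewrite mulf_neq0// gt_eqF.
have case2' w : H v w = 0 -> H w w != 0 -> 0 <= F v v.
  move=> Hvw Hw; have [|tw] := leP 0 (t w * t w0); first exact: case2.
  have Nw : - w = -1 *: w + 0 *: w by rewrite scale0r addr0 scaleN1r.
  apply: (case2 (- w)); rewrite Nw.
  - by rewrite (form_linr symH) Hvw; ring.
  - by rewrite (form_comb symH); apply: contraNneq Hw => <-; apply/eqP; ring.
  - by rewrite t2; lra.
(* Moving [z] along [w0] makes it orthogonal to [v]. If the result is isotropic, either [z] was
   already orthogonal to [v], or [t w1] is nonzero. *)
pose w1 := 1 *: z + (- (H v z / H v w0)) *: w0.
have Hvw1 : H v w1 = 0 by rewrite (form_linr symH); field.
have [Hw1|] := eqVneq (H w1 w1) 0; last exact: case2'.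
have [Hvz|Hvz] := eqVneq (H v z) 0; first exact: case2' Hvz Hz.
apply: (case1 w1) => //.
by rewrite t2 tz mulr0 add0r mulf_neq0// oppr_eq0 mulf_neq0// invr_eq0.
Qed.

End SymmetricForms.

(** The condition on [mu] bounds it below by [- F w w / H w w] where [H] is positive and above by
    [F u u / - H u u] where [H] is negative. The cross inequality makes these bounds compatible, and
    the supremum of the lower ones serves. *)
Lemma finsler (R : realType) (V : lmodType R) (F H : V -> V -> R) :
  symmetric_form F -> symmetric_form H ->
  (forall v, H v v = 0 -> 0 <= F v v) ->
  (exists u, H u u < 0) -> (exists w, 0 < H w w) ->
  exists mu, forall v, 0 <= F v v + mu * H v v.
Proof.
move=> symF symH FH [u0 Hu0] [w0 Hw0].
pose S := [set y | exists2 w, 0 < H w w & y = - F w w / H w w].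
have ubS u : H u u < 0 -> ubound S (F u u / - H u u).
  move=> Hu _ [w Hw ->]; rewrite ler_pdivrMr// mulrAC ler_pdivlMr ?oppr_gt0//.
  by rewrite mulrNN mulrC; exact: isotropic_nonneg_cross.
have S0 : S !=set0 by exists (- F w0 w0 / H w0 w0), w0.
have hasS : has_ubound S by eexists; exact: ubS Hu0.
exists (sup S) => v; case: (ltgtP (H v v) 0) => Hv.
- have := ge_sup S0 (ubS _ Hv); rewrite ler_pdivlMr ?oppr_gt0// mulrN; lra.
- have := ub_le_sup hasS (ex_intro2 _ _ v Hv erefl).
  by rewrite ler_pdivrMr//; lra.
- by rewrite Hv mulr0 addr0; exact: FH.
Qed.

Lemma mx_entryD (R : nmodType) m n (A B : 'M[R]_(m, n)) i j :
  (A + B) i j = A i j + B i j.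
Proof. exact: mxE. Qed.

Lemma mx_entryZ (R : pzRingType) m n a (A : 'M[R]_(m, n)) i j :
  (a *: A) i j = a * A i j.
Proof. exact: mxE. Qed.

(** * Homogenization and the S-lemma with equality *)

Section Homogenization.
Variables (R : realType) (n : nat).
Implicit Types (M A D : 'M[R]_n) (p e b x : 'cV[R]_n) (a c v : R).

(* Twice the polarization of the homogenization [t ^+ 2 * quad M p a (t^-1 *: x)]. *)
Definition homog_form M p a (u w : 'cV[R]_n * R^o) : R :=
  (u.1^T *m M *m w.1) 0 0 + u.2 * (p^T *m w.1) 0 0 + w.2 * (p^T *m u.1) 0 0
  + 2 * a * u.2 * w.2.

Lemma homog_form_sym M p a : M^T = M -> symmetric_form (homog_form M p a).
Proof.
move=> symM; split=> [u w|w k u1 u2 /=]; rewrite /homog_form.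
  have -> : (u.1^T *m M *m w.1) 0 0 = (w.1^T *m M *m u.1) 0 0.
    by rewrite -[u.1^T *m M *m w.1]trmxK mxE !trmx_mul trmxK symM mulmxA.
  by ring.
have -> : (k *: u1 + u2).1 = k *: u1.1 + u2.1 by [].
have -> : (k *: u1 + u2).2 = k * u1.2 + u2.2 by [].
rewrite [(_ + _)^T]linearD /= [(_ *: _)^T]linearZ /= !mulmxDl !mulmxDr.
by rewrite -!scalemxAl -!scalemxAr !mx_entryD !mx_entryZ; ring.
Qed.

Lemma homog_formE M p a x t : t != 0 ->
  homog_form M p a (x, t) (x, t) = 2 * t ^+ 2 * quad M p a (t^-1 *: x).
Proof.
move=> t0; rewrite /homog_form /quad /=.
rewrite [(_ *: _)^T]linearZ /= -!scalemxAl -!scalemxAr !mx_entryZ.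
by field.
Qed.

Lemma homog_form1 M p a x :
  homog_form M p a (x, 1) (x, 1) = 2 * quad M p a x.
Proof. by rewrite homog_formE ?oner_eq0// expr1n mulr1 invr1 scale1r. Qed.

Lemma homog_form_delta M p a (i j : 'I_n) :
  homog_form M p a (delta_mx i 0, 0) (delta_mx j 0, 0) = M i j.
Proof.
rewrite /homog_form /= !mul0r mulr0 !addr0 trmx_delta.
by rewrite -rowE -colE !mxE.
Qed.

Lemma homog_form_delta1 M p a (i : 'I_n) :
  homog_form M p a (delta_mx i 0, 0) (0, 1) = p i 0.
Proof.
rewrite /homog_form /= !mulmx0 -colE !mxE.
by ring.
Qed.

(** Polarization: a quadratic form vanishing everywhere vanishes on sums of two basis vectors, hence
    so do all entries of [M]. *)
Lemma sym_mx_anisotropic M : M^T = M -> M <> 0 ->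
  exists x, (x^T *m M *m x) 0 0 != 0.
Proof.
move=> symM M0; apply: contrapT => /forallNP iso; apply: M0.
have symB := @homog_form_sym M 0 0 symM.
have iso0 u : u.2 = 0 -> homog_form M 0 0 u u = 0.
  move=> u2; rewrite /homog_form u2 !mul0r mulr0 !addr0.
  by apply/eqP/negPn/negP; exact: iso.
apply/matrixP => i j; rewrite mxE -(@homog_form_delta M 0 0).
set u : 'cV[R]_n * R^o := (delta_mx i 0, 0).
set w : 'cV[R]_n * R^o := (delta_mx j 0, 0).
have := form_comb symB 1 1 u w; rewrite /= (iso0 u)// (iso0 w)//.
by rewrite iso0/= ?scaler0 ?addr0//; lra.
Qed.

Lemma s_lemma_equality A D b e c v : A^T = A -> D^T = D -> A <> 0 ->
  (exists x, quad A b c x = 0) ->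
  (exists x' x'', quad A b c x' < 0 < quad A b c x'') ->
  (forall x, quad A b c x = 0 -> v <= quad D e 0 x) ->
  exists mu, forall u, 0 <= homog_form D e (- v) u u + mu * homog_form A b c u u.
Proof.
move=> symA symD A0 [x0 hx0] [x' [x'' /andP[hx' hx'']]] fv.
have symF := @homog_form_sym D e (- v) symD.
have symH := @homog_form_sym A b c symA.
apply: (finsler symF symH); first last.
- by exists (x'', 1); rewrite homog_form1 mulr_gt0.
- by exists (x', 1); rewrite homog_form1 pmulr_rlt0.
pose t (u : 'cV[R]_n * R^o) : R := u.2.
have tl : scalar t by [].
apply: (isotropic_nonneg_extend symF symH tl).
- move=> [x s]; rewrite /t /= => t0; rewrite !homog_formE// => /eqP.
  rewrite !mulf_eq0 pnatr_eq0 (negbTE t0) /= => /eqP hx.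
  apply: mulr_ge0; first by apply: mulr_ge0 => //; exact: sqr_ge0.
  by have := fv _ hx; rewrite /quad; lra.
- by exists (x0, 1); rewrite ?oner_eq0// homog_form1 hx0 mulr0.
- have [x Ax] := sym_mx_anisotropic symA A0; exists (x, 0) => //.
  by rewrite /homog_form /= !mul0r mulr0 !addr0.
Qed.

(** A zero diagonal entry makes a basis vector isotropic for a semidefinite form. Pairing it with
    the other basis vectors gives the row, and with [(0, 1)] the linear coefficient. *)
Lemma s_lemma_equality_diag A D b e c v : A^T = A -> D^T = D -> A <> 0 ->
  (exists x, quad A b c x = 0) ->
  (exists x' x'', quad A b c x' < 0 < quad A b c x'') ->
  (forall x, quad A b c x = 0 -> v <= quad D e 0 x) ->
  exists mu, forall i, 0 <= D i i + mu * A i i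
    /\ (D i i + mu * A i i = 0 ->
        (forall j, D i j + mu * A i j = 0) /\ e i 0 + mu * b i 0 = 0).
Proof.
move=> symA symD A0 feas slater fv.
have [mu G_ge0] := s_lemma_equality symA symD A0 feas slater fv.
have symG : symmetric_form
    (fun u w => homog_form D e (- v) u w + mu * homog_form A b c u w).
  by apply: form_add; exact: homog_form_sym.
exists mu => i; have := G_ge0 (delta_mx i 0, 0).
rewrite !homog_form_delta => Gi; split=> // Gi0.
have Giu := psd_form_isotropic symG G_ge0 (u := (delta_mx i 0, 0)).
rewrite !homog_form_delta in Giu.
split=> [j|]; first by have := Giu Gi0 (delta_mx j 0, 0); rewrite !homog_form_delta.
by have := Giu Gi0 (0, 1); rewrite !homog_form_delta1.
Qed.

Lemma ep_value_lbound A D b e c : (-oo < ep_value D A e b c)%E ->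
  exists v, forall x, quad A b c x = 0 -> v <= quad D e 0 x.
Proof.
rewrite /ep_value; set S := (X in ereal_inf X) => S_bd.
have lbS x : quad A b c x = 0 -> (ereal_inf S <= (quad D e 0 x)%:E)%E.
  by move=> hx; apply: ereal_inf_lbound; exists x.
case: (ereal_inf S) S_bd lbS => [v _ lbS|_ lbS|//].
  by exists v => x /lbS; rewrite lee_fin.
(* An infimum [+oo] leaves no feasible point, so any bound works. *)
by exists 0 => x /lbS.
Qed.

End Homogenization.

(** * Entries and symmetry of the canonical blocks *)

Section Blocks.
Variable R : realType.

Lemma EmxE q r s : Emx R q r s = ((r + s).+1 == q)%:R.
Proof. by rewrite mxE addSn addnS !eqSS. Qed.

Lemma FmxE q r s : Fmx R q r s = (r + s == q)%N%:R.
Proof. by rewrite mxE addSn addnS !eqSS. Qed.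

Lemma Emx_mulE q (M : 'M[R]_q) r s : (Emx R q *m M) r s = M (rev_ord r) s.
Proof.
have rq := ltn_ord r.
rewrite !mxE (bigD1 (rev_ord r)) //= big1 => [|j jr].
  rewrite !mxE /= addr0 -[RHS]mul1r.
  by have -> : (r.+1 + (q - r.+1).+1 == q.+1)%N by lia.
rewrite !mxE; case: eqP => [e|]; last by rewrite mul0r.
by case/eqP: jr; apply: val_inj => /=; lia.
Qed.

(** Reversing the rows sends the diagonal of [J] to the antidiagonal and the superdiagonal to the
    support of [F]. Real blocks of the first family thus reduce to the second, with a shifted
    multiplier. *)
Lemma Emx_JrealE kappa q r s :
  (Emx R q *m Jreal kappa q) r s = Fmx R q r s + kappa * Emx R q r s.
Proof.
rewrite Emx_mulE !mxE -val_eqE /=; have rq := ltn_ord r.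
have [e1|ne1] := eqVneq (s : nat) (q - r.+1)%N.
  have -> : (r.+1 + s.+1 == q.+2)%N = false by lia.
  have -> : (r.+1 + s.+1 == q.+1)%N by lia.
  by rewrite add0r mulr1.
have -> : (r.+1 + s.+1 == q.+1)%N = false by lia.
rewrite mulr0 addr0; case: eqP => [e2|ne2].
  by have -> : (r.+1 + s.+1 == q.+2)%N by lia.
by have -> : (r.+1 + s.+1 == q.+2)%N = false by lia.
Qed.

Lemma Emx_tr q : (Emx R q)^T = Emx R q.
Proof. by apply/matrixP => r s; rewrite !mxE addnC. Qed.

Lemma Fmx_tr q : (Fmx R q)^T = Fmx R q.
Proof. by apply/matrixP => r s; rewrite !mxE addnC. Qed.

(** For even [q], row reversal respects the 2x2 blocks: diagonal blocks become the symmetric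
    [[[y, x], [x, -y]]], identities become exchange matrices. *)
Lemma Emx_Jpair_tr x y q : ~~ odd q ->
  (Emx R q *m Jpair x y q)^T = Emx R q *m Jpair x y q.
Proof.
move=> q_even; apply/matrixP => r s; rewrite mxE !Emx_mulE !mxE /=.
have rq := ltn_ord r; have sq := ltn_ord s.
have -> : (r./2 == (q - s.+1)./2) = (s./2 == (q - r.+1)./2) by lia.
have -> : (r./2 == (q - s.+1)./2.+1) = (s./2 == (q - r.+1)./2.+1) by lia.
have -> : odd (q - s.+1) = ~~ odd s by lia.
have -> : odd (q - r.+1) = ~~ odd r by lia.
by case: (odd r) (odd s) => [] [].
Qed.

Lemma Emx_Jmx_tr kappa q : (complex.Im kappa <> 0 -> ~~ odd q) ->
  (Emx R q *m Jmx kappa q)^T = Emx R q *m Jmx kappa q.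
Proof.
rewrite /Jmx; case: eqP => [_ _|? /(_ _)/Emx_Jpair_tr ->//].
apply/matrixP => r s; rewrite mxE !Emx_JrealE.
by rewrite -[in LHS](Emx_tr q) -[in LHS](Fmx_tr q) !mxE.
Qed.

Variable K : block_form R.

Lemma cf_Ablock_tr (i : 'I_(cf_m K)) : (cf_Ablock i)^T = cf_Ablock i.
Proof.
by rewrite /cf_Ablock linearZ /=; case: ifP; rewrite ?Emx_tr ?Fmx_tr.
Qed.

Lemma cf_Dblock_tr (i : 'I_(cf_m K)) : (cf_Dblock i)^T = cf_Dblock i.
Proof.
rewrite /cf_Dblock linearZ /=; case: ifP => [ik|_].
  by rewrite Emx_Jmx_tr//; exact: cf_pair_even.
by case: ifP; rewrite ?Emx_tr ?Fmx_tr.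
Qed.

Lemma cf_A_tr : (cf_A K)^T = cf_A K.
Proof.
rewrite /cf_A tr_block_mx !trmx0 tr_mxdiag; congr (block_mx _ _ _ _).
by apply: eq_mxdiag => i; exact: cf_Ablock_tr.
Qed.

Lemma cf_D_tr : (cf_D K)^T = cf_D K.
Proof.
rewrite /cf_D tr_block_mx !trmx0 tr_mxdiag; congr (block_mx _ _ _ _).
by apply: eq_mxdiag => i; exact: cf_Dblock_tr.
Qed.

Lemma mxdiag_RankE p (p_ : 'I_p -> nat) (B : forall i, 'M[R]_(p_ i)) i
    (r s : 'I_(p_ i)) :
  (\mxdiag_(j < p) B j) (tagnat.Rank i r) (tagnat.Rank i s) = B i r s.
Proof.
transitivity (submxblock (\mxdiag_(j < p) B j) i i r s); first by rewrite [RHS]mxE.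
by rewrite /mxdiag mxblockK eqxx conform_mx_id.
Qed.

Lemma cf_A_coord (i : 'I_(cf_m K)) (r s : 'I_(cf_size i)) :
  cf_A K (cf_coord r) (cf_coord s) = cf_Ablock i r s.
Proof. by rewrite /cf_A /cf_coord block_mxEul mxdiag_RankE. Qed.

Lemma cf_D_coord (i : 'I_(cf_m K)) (r s : 'I_(cf_size i)) :
  cf_D K (cf_coord r) (cf_coord s) = cf_Dblock i r s.
Proof. by rewrite /cf_D /cf_coord block_mxEul mxdiag_RankE. Qed.

End Blocks.

(* The consequence of positive semidefiniteness that excludes all large blocks. *)
Definition psd_diag_condition (R : realType) q (M : 'M[R]_q) :=
  forall r, 0 <= M r r /\ (M r r = 0 -> forall s, M r s = 0).

(** * Pencils excluded by the diagonal condition *)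

Lemma pencil_FE_size2 (R : realType) q (tau nu : R) : tau <> 0 ->
  psd_diag_condition (tau *: (Fmx R q + nu *: Emx R q)) -> (1 < q)%N ->
  q = 2%N /\ 0 <= tau.
Proof.
move=> /eqP tau0; set M := tau *: _ => psdM.
have ME r s : M r s = tau * ((r + s == q)%N%:R + nu * ((r + s).+1 == q)%:R).
  by rewrite mx_entryZ mx_entryD mx_entryZ EmxE FmxE.
case: q => [|[|q]]// in M psdM ME * => _.
(* Row 0 has zero diagonal and last entry [tau * nu], so [nu = 0]. Row 1 then has last entry [tau]
   and zero diagonal unless [q = 2], where the diagonal entry is [tau] itself. *)
have [_] := psdM 0; rewrite ME mulr0 addr0 mulr0 => /(_ erefl ord_max).
rewrite ME /= add0n eqxx (ltn_eqF (ltnSn _)) add0r mulr1 => /eqP.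
rewrite mulf_eq0 (negbTE tau0) /= => /eqP nu0.
have {}ME r s : M r s = tau * (r + s == q.+2)%N%:R.
  by rewrite ME nu0 mul0r addr0.
have [] := psdM 1; rewrite ME.
case: q => [|q] in M psdM ME *; first by rewrite mulr1.
rewrite mulr0 => _ /(_ erefl ord_max); rewrite ME /= add1n eqxx mulr1.
by move/eqP; rewrite (negbTE tau0).
Qed.

Lemma pencil_EF_size1 (R : realType) q (tau nu : R) : tau <> 0 ->
  psd_diag_condition (tau *: (Emx R q + nu *: Fmx R q)) -> (0 < q)%N ->
  q = 1%N.
Proof.
move=> /eqP tau0; set M := tau *: _ => psdM.
have ME r s : M r s = tau * (((r + s).+1 == q)%:R + nu * (r + s == q)%N%:R).
  by rewrite mx_entryZ mx_entryD mx_entryZ EmxE FmxE.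
case: q => [|[|q]]// in M psdM ME * => _.
have [_] := psdM 0; rewrite ME mulr0 addr0 mulr0 => /(_ erefl ord_max).
rewrite ME /= add0n eqxx (ltn_eqF (ltnSn _)) mulr0 addr0 mulr1 => /eqP.
by rewrite (negbTE tau0).
Qed.

Lemma pencil_pair_false (R : realType) q (tau mu x y : R) : tau <> 0 -> y <> 0 ->
  (0 < q)%N -> ~~ odd q ->
  ~ psd_diag_condition (tau *: (Emx R q *m Jpair x y q + mu *: Emx R q)).
Proof.
move=> /eqP tau0 /eqP y0; set M := tau *: _ => q_gt0 q_even psdM.
have ME r s :
    M r s = tau * (Jpair x y q (rev_ord r) s + mu * ((r + s).+1 == q)%:R).
  by rewrite mx_entryZ mx_entryD mx_entryZ EmxE Emx_mulE.
case: q => [|[|[|[|q]]]]// in M psdM ME q_gt0 q_even *.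
  (* In size 2 the diagonal entries are [tau * y] and [- tau * y]. *)
  have [M0 _] := psdM 0; have [M1 _] := psdM 1; move: M0 M1.
  rewrite !ME !mxE /= !mulr0 !addr0 => M0 M1.
  have : tau * y = 0 by lra.
  by move/eqP; rewrite mulf_eq0 (negbTE tau0) (negbTE y0).
(* From size 4 on, row 0 has zero diagonal, but its next-to-last entry is [tau * y]. *)
have lt_s : (q.+2 < q.+4)%N by [].
have M00 : M 0 0 = 0 by rewrite ME !mxE /= mulr0 addr0 mulr0.
have [_ /(_ M00 (Ordinal lt_s))/eqP] := psdM 0; rewrite ME !mxE.
have qe : odd q = false by move: q_even => /=; case: (odd q).
rewrite /= uphalf_half qe add0n eqxx /= (ltn_eqF (ltnSn _)).
by rewrite mulr0 addr0; apply/negP; rewrite mulf_neq0.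
Qed.

(** For a left eigenvector, coordinate [i] reads [kappa v_i + v_(i-1) = z v_i], without [v_(i-1)]
    when [i = 0]. If [z] differs from [kappa], all coordinates vanish by induction. *)
Lemma eigenvalue_jordan_block (F : fieldType) (kappa : F) q (z : F) :
  eigenvalue (\matrix_(r < q, s < q) if s == r then kappa
                 else if (s == r.+1 :> nat) then 1 else 0) z -> z = kappa.
Proof.
move=> /eigenvalueP[v vJ v0]; apply/eqP; apply: contraNT v0 => zk.
apply/eqP/rowP => i; rewrite mxE.
have [m] := ubnP (val i); elim: m i => // m IH i; rewrite ltnS => im.
have := congr1 (fun w : 'rV_q => w 0 i) vJ; rewrite !mxE (bigD1 i) //= mxE eqxx.
rewrite big1 => [|j ji]; last first.
  rewrite mxE eq_sym (negbTE ji); case: eqP => [e|_]; last by rewrite mulr0.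
  by rewrite IH ?mul0r// -e.
move/eqP; rewrite addr0 mulrC -subr_eq0 -mulrBl mulf_eq0 subr_eq0.
by rewrite eq_sym (negbTE zk) => /eqP.
Qed.

(** * Block pencils of the canonical form *)

Section BlockPencil.
Variables (R : realType) (K : block_form R) (mu : R).
Implicit Type i : 'I_(cf_m K).

Let pencil i := cf_Dblock i + mu *: cf_Ablock i.

Lemma cf_tau_neq0 i : cf_tau i <> 0.
Proof. by case: (cf_tauP i) => ->; apply/eqP; rewrite ?oppr_eq0 oner_eq0. Qed.

Lemma pencil_real i : (i < cf_k K)%N -> psd_diag_condition (pencil i) ->
  complex.Im (cf_kappa i) = 0.
Proof.
move=> ik psdM; apply/eqP/negPn/negP => /eqP Im0.
apply: (pencil_pair_false (cf_tau_neq0 (i := i)) Im0 (cf_size_gt0 i)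
          (cf_pair_even ik Im0) (mu := mu) (x := complex.Re (cf_kappa i))).
move: psdM; rewrite /pencil /cf_Dblock /cf_Ablock ik (leq_trans ik (cf_k_le_p K)).
by rewrite /Jmx (negbTE (introN eqP Im0)) scalerA [mu * _]mulrC -scalerA -scalerDr.
Qed.

Lemma pencil_size_le2 i : (i < cf_p K)%N -> psd_diag_condition (pencil i) ->
  (1 < cf_size i)%N -> cf_size i = 2%N /\ 0 <= cf_tau i.
Proof.
move=> ip psdM; have [nu pencilE] :
    exists nu, pencil i = cf_tau i *: (Fmx R (cf_size i) + nu *: Emx R (cf_size i)).
  have muE : pencil i = cf_tau i *: ((if (i < cf_k K)%N
      then Emx R (cf_size i) *m Jmx (cf_kappa i) (cf_size i)
      else Fmx R (cf_size i)) + mu *: Emx R (cf_size i)).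
    rewrite /pencil /cf_Dblock /cf_Ablock ip.
    by rewrite scalerA [mu * _]mulrC -scalerA -scalerDr.
  case: ifPn muE => [ik ->|_ ->]; last by exists mu.
  exists (complex.Re (cf_kappa i) + mu); congr (_ *: _).
  rewrite /Jmx (pencil_real ik psdM) eqxx; apply/matrixP => r s.
  by rewrite !mx_entryD Emx_JrealE !mx_entryZ; ring.
by rewrite pencilE in psdM => /(pencil_FE_size2 (cf_tau_neq0 (i := i)) psdM).
Qed.

Lemma pencil_size1 i : (cf_p K <= i)%N -> psd_diag_condition (pencil i) ->
  cf_size i = 1%N.
Proof.
move=> pi psdM; apply: (pencil_EF_size1 (cf_tau_neq0 (i := i)) (nu := mu)) => //.
  move: psdM; rewrite /pencil /cf_Dblock /cf_Ablock.
  have -> : (i < cf_p K)%N = false by rewrite ltnNge pi.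
  have -> : (i < cf_k K)%N = false.
    by rewrite ltnNge (leq_trans (cf_k_le_p K) pi).
  by rewrite scalerA [mu * _]mulrC -scalerA -scalerDr.
exact: cf_size_gt0.
Qed.

End BlockPencil.

(** * Consequences of boundedness for the canonical form *)

Theorem theorem10 (R : realType) (K : block_form R)
    (b e : 'cV[R]_(cf_dim K)) (c : R)
    (hEP : ep_assumption (cf_A K) b c)
    (hb : cf_normalized b)
    (hbdd : (-oo < ep_value (cf_D K) (cf_A K) e b c)%E) :
  [/\ forall i : 'I_(cf_m K), (i < cf_p K)%N -> (cf_size i <= 2)%N,
      forall i : 'I_(cf_m K), (cf_p K <= i)%N -> cf_size i = 1%N
    & forall i : 'I_(cf_m K), (i < cf_k K)%N ->
        forall z : complex R,
          eigenvalue (map_mx (real_complex R) (Jmx (cf_kappa i) (cf_size i))) z ->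
          complex.Im z = 0]
  /\
  (forall (i : 'I_(cf_m K)) (hi : cf_size i = 2%N) (xbar : 'cV[R]_(cf_dim K)),
     ep_feasible (cf_A K) b c xbar ->
     let r := cf_coord (cast_ord (esym hi) (0 : 'I_2)) in
     let r1 := cf_coord (cast_ord (esym hi) (1 : 'I_2)) in
     let pi := cf_tau i * xbar r 0 * xbar r1 0 in
     cf_tau i = 1 /\
     [\/ e r 0 = 0 /\ e r1 0 <> 0,
         [/\ e r 0 = 0, e r1 0 = 0 & pi = 0]
       | [/\ e r 0 = 0, e r1 0 = 0 & pi <> 0]]).
Proof.
have [feas _ A0 slater] := hEP; have [v fv] := ep_value_lbound hbdd.
have [mu diag] :=
  s_lemma_equality_diag (cf_A_tr K) (cf_D_tr K) A0 feas slater fv.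
have block i (r s : 'I_(cf_size i)) : (cf_Dblock i + mu *: cf_Ablock i) r s =
    cf_D K (cf_coord r) (cf_coord s) + mu * cf_A K (cf_coord r) (cf_coord s).
  by rewrite cf_A_coord cf_D_coord mx_entryD; congr (_ + _); exact: mx_entryZ.
have psdM (i : 'I_(cf_m K)) : psd_diag_condition (cf_Dblock i + mu *: cf_Ablock i).
  move=> r; rewrite block; have [M_ge0 M0] := diag (cf_coord r).
  by split=> // /M0[Mr _] s; rewrite block.
have realJ (i : 'I_(cf_m K)) : (i < cf_k K)%N -> complex.Im (cf_kappa i) = 0.
  by move=> ik; exact: pencil_real ik (psdM i).
split; first split.
- move=> i ip; rewrite leqNgt; apply/negP => size_gt2.
  have [size2 _] := pencil_size_le2 ip (psdM i) (ltnW size_gt2).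
  by rewrite size2 in size_gt2.
- by move=> i pi; exact: pencil_size1 pi (psdM i).
- move=> i ik z; rewrite /Jmx (realJ _ ik) eqxx => ev.
  suff -> : z = (complex.Re (cf_kappa i))%:C%C by [].
  apply: (@eigenvalue_jordan_block _ _ (cf_size i)); move: ev; congr (eigenvalue _ z).
  by apply/matrixP => r s; rewrite !mxE; case: ifP => // _; case: ifP.
move=> i hi x _ r r1 pi.
have ip : (i < cf_p K)%N.
  rewrite ltnNge; apply/negP => ip.
  by have := pencil_size1 ip (psdM i); rewrite hi.
have [_ tau_ge0] := pencil_size_le2 ip (psdM i) (eq_leq (esym hi)).
have br : b r 0 = 0 by apply: hb => // ik; exact: realJ.
have er : e r 0 = 0.
  have [_ diag0] := diag r; have [|_] := diag0; last by rewrite br mulr0 addr0.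
  (* In size 2 the top left entries of [E], [F] and [E J] with real [kappa] are all 0, so the
     diagonal entry vanishes for every [mu]. *)
  rewrite -block /cf_Dblock /cf_Ablock ip mx_entryD 3!mx_entryZ EmxE.
  have size_neq0 : (0 == cf_size i)%N = false by rewrite hi.
  have size_neq1 : (1 == cf_size i)%N = false by rewrite hi.
  rewrite size_neq1 !mulr0 addr0; case: ifP => [ik|_].
    rewrite /Jmx realJ// eqxx Emx_JrealE EmxE FmxE size_neq0 size_neq1.
    by rewrite add0r !mulr0.
  by rewrite FmxE size_neq0 mulr0.
split.
  case: (cf_tauP i) => // tauN; move: tau_ge0.
  by rewrite tauN lerNr oppr0 ler10.
(* Once [e r 0 = 0], the three alternatives exhaust the cases. *)
have [er1|/eqP er1] := eqVneq (e r1 0) 0; last by constructor 1.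
by have [pi0|/eqP pi0] := eqVneq pi 0; [constructor 2|constructor 3].
Qed.
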